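(* Let $N \geq 5$ and let $H$ be a fixed $N\times N$ Hermitian matrix with $N$ distinct real eigenvalues $\mu_1<\dots<\mu_N$. Let $v$ be a random unit vector, uniformly distributed on the unit sphere of $\mathbb{C}^N$, and for $t\ge 0$ let $G_t := H + i t\, vv^*$. Then, almost surely with respect to the randomness of $v$, the eigenvalue trajectories of $G_t$, $t\ge 0$, neither intersect nor self-intersect. Explicitly: almost surely, for every $t\ge 0$ the matrix $G_t$ has $N$ distinct eigenvalues, and for all $t,s\ge 0$ with $t\neq s$ the spectra of $G_t$ and $G_s$ are disjoint.
   Context: $vv^*$ denotes the rank-one orthogonal projection onto $v$. If $\lambda_1(t),\dots,\lambda_N(t)$ denote the eigenvalues of $G_t$ (with arbitrary indexing), the statement is: almost surely there are no $i\neq j$ and $t,s\ge 0$ with $\lambda_i(t)=\lambda_j(s)$, and no $j$ and $t\neq s$ with $\lambda_j(t)=\lambda_j(s)$. *)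

(* Defs.v *)
From HB Require Import structures.
From mathcomp Require Import all_boot all_order all_algebra.
From mathcomp Require Import all_classical all_reals all_analysis.
From mathcomp Require Import complex.
Set Implicit Arguments. Unset Strict Implicit. Unset Printing Implicit Defensive.
Import Order.TTheory GRing.Theory Num.Theory.
Local Open Scope ring_scope.
Local Open Scope classical_set_scope.

Definition adjmx (R : rcfType) (m n : nat) (A : 'M[R[i]]_(m, n)) : 'M[R[i]]_(n, m) :=
  (map_mx (@conjc R) A)^T.

Definition hermitian_mx (R : rcfType) (n : nat) (A : 'M[R[i]]_n) : Prop :=
  adjmx A = A.

Definition unitary_mx (R : rcfType) (n : nat) (U : 'M[R[i]]_n) : Prop :=
  U *m adjmx U = 1%:M.

Definition n_distinct_eigenvalues (R : rcfType) (n : nat) (A : 'M[R[i]]_n)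
  (k : nat) : Prop :=
  exists s : seq R[i], [/\ uniq s, size s = k &
     forall z : R[i], eigenvalue A z <-> z \in s].

Definition Gt (R : rcfType) (n : nat) (H : 'M[R[i]]_n) (v : 'cV[R[i]]_n) (t : R)
  : 'M[R[i]]_n :=
  H + (Complex 0 t) *: (v *m adjmx v).

Definition unit_vector (R : rcfType) (n : nat) (v : 'cV[R[i]]_n) : Prop :=
  \sum_(j < n) conjc (v j 0) * v j 0 = 1.

(* Identification C^n = (R x R)^n used to equip C^n with its Borel
   sigma-algebra (the product sigma-algebra on n.-tuple (R * R)). *)
Definition encode (R : realType) (n : nat) (x : 'cV[R[i]]_n) : n.-tuple (R * R)%type :=
  [tuple (complex.Re (x j 0), complex.Im (x j 0)) | j < n].

(* v : Omega -> C^n is a random vector uniformly distributed on the unit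
   sphere: it is measurable, lies on the unit sphere almost surely, and its law
   is invariant under every unitary matrix (the uniform measure on the sphere
   being the unique unitarily invariant probability measure on it). *)
Definition uniform_on_sphere (R : realType) (d : measure_display)
  (Omega : measurableType d) (P : probability Omega R) (n : nat)
  (v : Omega -> 'cV[R[i]]_n) : Prop :=
  [/\ measurable_fun setT (@encode R n \o v),
      {ae P, forall w, unit_vector (v w)} &
      forall U : 'M[R[i]]_n, unitary_mx U ->
        forall A : set (n.-tuple (R * R)%type), measurable A ->
          P ((@encode R n \o v) @^-1` A) =
          P ((fun w => @encode R n (U *m v w)) @^-1` A)].

(* Main.v *)
(* Diagonalise H = U^* D U, D = diag(mu_j), and put u = U v, p_j = |u_j|^2.
   Writing w = prod_j (X - mu_j) and q = sum_j p_j prod_(k <> j) (X - mu_k), the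
   characteristic polynomial of D + s u u^* is w - s q.  If two spectra met at z
   then q(z) = w(z) = 0, so z = mu_j and p_j = 0, which has probability 0.

   A double root of w - s q with s imaginary is, after conjugation, also one for
   -s.  A Sylvester-type matrix S(g), linear in g and singular exactly when g has
   a double root, turns this into: M_p = S(w)^-1 S(q) has both eigenvalues 1/s
   and -1/s, so Y |-> M_p Y + Y M_p^T is singular.  That operator is linear in p,
   hence its determinant is a polynomial in p.  It is non-zero at p = e_j when
   mu_j is the smallest eigenvalue: there the eigenvalues of M_p are
   1/(mu_k - mu_j) > 0.

   It remains to see that a determinant F(v) = det (sum_j |v_j|^2 L_j) with
   det L_j <> 0 for some j is almost surely non-zero.  For each Householder
   reflection R_x with integer parameters x, the event F(R_x v) = 0 has the same
   probability c as F(v) = 0, so by Fatou the limsup, taken over one parameter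
   after the other, has probability at least c.  On that limsup F(R_x v), which
   up to a factor is polynomial in x, vanishes for all real x; but some R_x v is
   proportional to e_j. *)
Require Import Defs.
From HB Require Import structures.
From mathcomp Require Import all_boot all_order all_algebra.
From mathcomp Require Import all_classical all_reals all_analysis.
From mathcomp Require Import complex.
From mathcomp Require Import ring zify.
Set Implicit Arguments. Unset Strict Implicit. Unset Printing Implicit Defensive.
Import Order.TTheory GRing.Theory Num.Theory.
Local Open Scope ring_scope.

(** * A Sylvester-type matrix detecting double roots *)

Section Discriminant.
Variables (C : numClosedFieldType) (K : nat).
Implicit Types (f g : {poly C}) (z : C).

(* A double root of g is a common root of g' and (K+1) g - X g'.  For deg g <= K+1
   both have degree at most K, so that this Sylvester matrix has the exact size
   2K: it is invertible also when g has simple roots and degree K only. *)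
Definition disc_mx g : 'M[C]_(K + K) :=
  col_mx (\matrix_(i < K, j < K + K) ('X^i * g^`())`_j)
         (\matrix_(i < K, j < K + K) ('X^i * (g *+ K.+1 - 'X * g^`()))`_j).

Fact disc_mx_is_linear : linear disc_mx.
Proof.
move=> a f g; apply/matrixP => i j.
rewrite !mxE; case: (fintype.split i) => k; rewrite !mxE derivD derivZ.
  by rewrite mulrDr coefD -scalerAr coefZ.
rewrite -coefZ -coefD scalerAr -mulrDr; congr ('X^k * _)`_j.
rewrite mulrnDl mulrDr scalerDr scalerN scalerMnr scalerAr.
by rewrite opprD addrACA.
Qed.
HB.instance Definition _ :=
  GRing.isLinear.Build C {poly C} 'M[C]_(K + K) *:%R disc_mx disc_mx_is_linear.

(** The coefficient at X^j is (K+1-j) g_j, so the top one, at j = K+1, cancels. *)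
Lemma size_polar g : (size g <= K.+2)%N ->
  (size (g *+ K.+1 - 'X * g^`())%R <= K.+1)%N.
Proof.
move=> sg; apply/leq_sizeP => j lej.
rewrite coefB coefMn coefXM coef_deriv.
case: j lej => [//|j] lej /=.
have [->|nj] := eqVneq j K; first by rewrite subrr.
by rewrite (leq_sizeP _ _ sg) ?mul0rn ?subrr// ltnS ltn_neqAle eq_sym nj.
Qed.

Lemma size_deriv_le n g : (size g <= n.+1)%N -> (size g^`() <= n)%N.
Proof.
move=> sg; apply/leq_sizeP => j lej.
by rewrite coef_deriv (leq_sizeP _ _ sg) ?mul0rn.
Qed.

(** Each row lists the coefficients of some X^i h with i < K and deg h <= K. These fit into 2K
    columns, so multiplying by the vector of powers of z evaluates X^i h at z. *)
Lemma disc_mx_root g z : (size g <= K.+2)%N -> root g z -> root g^`() z ->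
  disc_mx g *m (\col_(j < K + K) z ^+ j) = 0.
Proof.
move=> sg /eqP gz /eqP g'z.
have E (h : {poly C}) : (size h <= K.+1)%N -> h.[z] = 0 ->
    (\matrix_(i < K, j < K + K) ('X^i * h)`_j) *m
    (\col_(j < K + K) z ^+ j) = 0.
  move=> sh hz; apply/matrixP => i j; rewrite !mxE.
  under eq_bigr do rewrite !mxE.
  rewrite -horner_coef_wide; first by rewrite hornerM hz mulr0.
  rewrite mulrC; case: (eqVneq h 0) => [->|h0]; first by rewrite mul0r size_poly0.
  rewrite size_mulXn//; have := ltn_ord i; lia.
rewrite mul_col_mx !E ?col_mx0 ?size_polar ?size_deriv_le//.
by rewrite !hornerE hornerMn gz g'z mulr0 mul0rn subrr.
Qed.

Lemma size_deriv_char0 g : (size g^`() = (size g).-1)%N.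
Proof.
have [->|g0] := eqVneq g 0; first by rewrite deriv0 size_poly0.
apply/eqP; rewrite eqn_leq size_deriv_le ?(leqSpred (size g))//=.
case E : (size g) => [//|[//|n]] /=.
rewrite ltnNge; apply/negP => /leq_sizeP /(_ n (leqnn _)).
rewrite coef_deriv => /eqP; rewrite -mulr_natr mulf_eq0 pnatr_eq0 orbF => /eqP H.
by move: g0; rewrite -lead_coef_eq0 /lead_coef E /= H eqxx.
Qed.

(** A vector in the left kernel is a relation a g1 + b g2 = 0 with deg a, deg b < K. A common root
    of g1 and g2 would be a double root of g, so they are coprime, and a degree count kills a and
    b. *)
Lemma disc_mx_unit g : (K < size g <= K.+2)%N ->
  (forall z, root g z -> root g^`() z -> False) -> disc_mx g \in unitmx.
Proof.
move=> /andP[sg1 sg2] simple.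
rewrite unitmxE unitfE; apply/negP => /det0P [u u0].
rewrite -[u]hsubmxK mul_row_col.
set g1 := g^`(); set g2 := g *+ K.+1 - 'X * g^`().
set a := lsubmx u; set b := rsubmx u => ab0.
have coefE (c : 'rV[C]_K) (h : {poly C}) (j : 'I_(K + K)) :
    (c *m \matrix_(i < K, j < K + K) ('X^i * h)`_j) 0 j = (rVpoly c * h)`_j.
  rewrite mxE /rVpoly poly_def mulr_suml coef_sum.
  apply: eq_bigr => i _; rewrite mxE -scalerAl coefZ; congr (_ * _).
  by case: insubP => [k _ /val_inj ->|]//; rewrite ltn_ord.
have s1 : (size g1 <= K.+1)%N by rewrite size_deriv_le.
have s2 : (size g2 <= K.+1)%N by rewrite size_polar.
have sM (c : 'rV[C]_K) (h : {poly C}) : (size h <= K.+1)%N -> (size (rVpoly c * h)%R <= K + K)%N.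
  move=> sh; apply: leq_trans (size_polyMleq _ _) _.
  have := size_poly K (fun k => if insub k is Some i then c 0 i else 0).
  rewrite -/(rVpoly c); lia.
have P0 : rVpoly a * g1 + rVpoly b * g2 = 0.
  apply/polyP => j; rewrite coef0.
  case: (ltnP j (K + K)) => lj; last first.
    apply/leq_sizeP: j lj; rewrite (leq_trans (size_polyD _ _))// geq_max.
    by rewrite !sM.
  have := congr1 (fun m : 'rV_(K + K) => m 0 (Ordinal lj)) ab0.
  by rewrite mxE !coefE /= coefD mxE.
have cop : coprimep g1 g2.
  apply: Pdiv.ClosedField.root_coprimep => z r1; apply/negP => /eqP r2.
  apply: (simple z) => //.
  move: r2; rewrite /g2 !hornerE hornerMn.
  move/eqP: (r1) => ->; rewrite mulr0 subr0 => /eqP.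
  by rewrite -mulr_natr mulf_eq0 pnatr_eq0 orbF.
have srV (c : 'rV[C]_K) : (size (rVpoly c) <= K)%N.
  exact: size_poly.
have rV0 (c : 'rV[C]_K) : rVpoly c = 0 -> c = 0.
  by move=> c0; rewrite -(rVpolyK c) c0 linear0.
(* By Gauss, h divides the polynomial of y; having degree exactly K, it is too large unless y =
   0. *)
have finish (x y : 'rV[C]_K) (h k : {poly C}) : (size h = K.+1)%N -> k != 0 -> coprimep h k ->
    rVpoly x * h + rVpoly y * k = 0 -> x = 0 /\ y = 0.
  move=> sh k0 hk E.
  have h0 : h != 0 by rewrite -size_poly_eq0 sh.
  have : h %| rVpoly y * k.
    move/eqP: E; rewrite addrC addr_eq0 => /eqP ->; rewrite -mulNr; exact: dvdp_mulIr.
  rewrite Gauss_dvdpl// => dv.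
  have y0 : rVpoly y = 0.
    apply: contraTeq dv => y0; apply/negP => /(dvdp_leq y0).
    by rewrite sh leqNgt ltnS srV.
  split; last exact: rV0.
  move/eqP: E; rewrite y0 mul0r addr0 mulf_eq0 (negPf h0) orbF => /eqP; exact: rV0.
have sd := size_deriv_char0 g.
suff [a0 b0] : a = 0 /\ b = 0.
  by move: u0; rewrite -[u]hsubmxK -/a -/b a0 b0 row_mx0 eqxx.
(* One of the two polynomials has degree exactly K: [g1] when deg g = K+1, and [g2] when deg g = K,
   with leading coefficient (K+1) g_K - K g_K = g_K. *)
have [sgE|sgE] : size g = K.+2 \/ size g = K.+1 by lia.
  have sg1E : size g1 = K.+1 by rewrite /g1 sd sgE.
  (* If [g2] = 0, coprimality makes [g1] constant, hence K = 0, and then u is an empty vector,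
     contradicting [u0]. *)
  have [g20|g20] := eqVneq g2 0; last exact: (finish _ _ g1 g2).
  have : size g1 = 1%N by apply/eqP; move: cop; rewrite g20 coprimep0 /eqp size_poly_eq1 /eqp.
  rewrite sg1E => -[K0]; move: u0 => /eqP; case; apply/matrixP => i [j lj].
  by exfalso; lia.
have sg2E : size g2 = K.+1.
  apply/eqP; rewrite eqn_leq s2 ltnNge; apply/negP => /leq_sizeP /(_ K (leqnn _)).
  rewrite coefB coefMn coefXM coef_deriv => /eqP.
  have -> : (g`_K *+ K.+1 - (if K == 0%N then 0 else g`_K.-1.+1 *+ K.-1.+1)) = g`_K.
    by case: (K) => [|k] /=; rewrite ?subr0 ?mulr1n// [_ *+ k.+2]mulrS addrK.
  by rewrite (_ : g`_K = lead_coef g) ?lead_coef_eq0 -?size_poly_eq0 /lead_coef ?sgE.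
have [g10|g10] := eqVneq g1 0.
  have : size g2 = 1%N by apply/eqP; move: cop; rewrite g10 coprime0p /eqp size_poly_eq1 /eqp.
  rewrite sg2E => -[K0]; move: u0 => /eqP; case; apply/matrixP => i [j lj].
  by exfalso; lia.
have := finish b a g2 g1 sg2E g10; rewrite coprimep_sym addrC => /(_ cop P0) [? ?].
by split.
Qed.

End Discriminant.

(** * The Lyapunov operator Y |-> M Y + Y M^T *)

Lemma eigenvalueNunit (F : fieldType) n (M : 'M[F]_n) l :
  eigenvalue M l = (M - l%:M \notin unitmx).
Proof. by rewrite /eigenvalue /eigenspace kermx_eq0 row_free_unit. Qed.

Section Lyapunov.
Variable F : closedFieldType.

Definition lyap_mx n (M : 'M[F]_n) : 'M[F]_(n * n) :=
  lin_mulmx M + lin_mulmxr M^T.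

Fact lyap_mx_is_linear n : linear (@lyap_mx n).
Proof.
move=> a A B; rewrite /lyap_mx !linearP /=.
by rewrite scalerDr addrACA.
Qed.
HB.instance Definition _ n :=
  GRing.isLinear.Build F 'M[F]_n 'M[F]_(n * n) *:%R (@lyap_mx n)
    (@lyap_mx_is_linear n).

Lemma mul_lyap_mx n (M Y : 'M[F]_n) :
  mxvec Y *m lyap_mx M = mxvec (M *m Y + Y *m M^T).
Proof. by rewrite mulmxDr !mul_rV_lin mxvecK /= linearD. Qed.

(** One linear factor is peeled off at a time. Since M commutes with M - l, the matrix (M - l) Y
    solves the same equation and is 0 by induction; what is left is Y (M^T + l) = 0 with an
    invertible factor. *)
Lemma anticommute_eq0 n (M Y : 'M[F]_n.+1) (s : seq F) :
  {in s, forall l, M^T + l%:M \in unitmx} -> M *m Y + Y *m M^T = 0 ->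
  horner_mx M (\prod_(l <- s) ('X - l%:P)) *m Y = 0 -> Y = 0.
Proof.
elim: s Y => [|l s IH] Y sM E; first by rewrite big_nil rmorph1 mul1mx.
rewrite big_cons mulrC rmorphM /= -mulmxE -mulmxA rmorphB /= horner_mx_X.
rewrite horner_mx_C => H.
have EY : (M - l%:M) *m Y = - (Y *m (M^T + l%:M)).
  rewrite mulmxBl mulmxDr mul_scalar_mx mul_mx_scalar opprD.
  by congr (_ - _); apply/eqP; rewrite -addr_eq0 E.
have Y'0 : (M - l%:M) *m Y = 0.
  apply: IH => //; first by move=> k ks; apply: sM; rewrite inE ks orbT.
  have -> : M *m ((M - l%:M) *m Y) = (M - l%:M) *m (M *m Y).
    by rewrite !mulmxA mulmxBl mulmxBr scalar_mxC.
  by rewrite -mulmxA -mulmxDr E mulmx0.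
have := congr1 (mulmx^~ (invmx (M^T + l%:M))) EY.
rewrite Y'0 mul0mx mulNmx mulmxK ?sM ?inE ?eqxx// => /eqP.
by rewrite eq_sym oppr_eq0 => /eqP.
Qed.

(** By Cayley-Hamilton, the factors of the characteristic polynomial can be used in
    [anticommute_eq0]: M^T + l is invertible because -l is not an eigenvalue. *)
Lemma lyap_mx_unit n (M : 'M[F]_n) :
  (forall l, eigenvalue M l -> ~~ eigenvalue M (- l)) -> lyap_mx M \in unitmx.
Proof.
case: n M => [|n] M noopp; first by rewrite unitmxE det_mx00 unitr1.
rewrite unitmxE unitfE; apply/negP => /det0P [u u0].
rewrite -[u]vec_mxK mul_lyap_mx => /eqP; rewrite mxvec_eq0 => /eqP E.
move/eqP: u0; apply; rewrite -(vec_mxK u).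
have [r rE] := closed_field_poly_normal (char_poly M).
rewrite (monicP (char_poly_monic M)) scale1r in rE.
suff -> : vec_mx u = 0 by rewrite linear0.
apply: (anticommute_eq0 (s := r) _ E); last first.
  by rewrite -rE Cayley_Hamilton mul0mx.
move=> l; rewrite -root_prod_XsubC -rE -eigenvalue_root_char => /noopp.
rewrite eigenvalueNunit negbK -unitmx_tr linearB /= tr_scalar_mx.
by rewrite raddfN opprK.
Qed.
End Lyapunov.

(** * The secular polynomial and the pencil of its double roots *)

Section Pencil.
Variables (C : numClosedFieldType) (K : nat) (mu : 'I_K.+1 -> C).
Hypothesis K_gt0 : (0 < K)%N.
Hypothesis mu_inj : injective mu.
Hypothesis mu_real : forall j, mu j \is Num.real.

Definition full_poly : {poly C} := \prod_j ('X - (mu j)%:P).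
Definition cofactor_poly j : {poly C} := \prod_(k | k != j) ('X - (mu k)%:P).
Definition secular_poly (p : 'I_K.+1 -> C) (s : C) : {poly C} :=
  full_poly - s *: \sum_j p j *: cofactor_poly j.

Lemma full_polyE j : full_poly = ('X - (mu j)%:P) * cofactor_poly j.
Proof. by rewrite /full_poly (bigD1 j). Qed.

Lemma root_prodXsubC (P : pred 'I_K.+1) z :
  root (\prod_(k | P k) ('X - (mu k)%:P)) z -> exists2 k, P k & z = mu k.
Proof.
rewrite rootE horner_prod => /prodf_eq0 [k Pk].
by rewrite hornerXsubC subr_eq0 => /eqP ->; exists k.
Qed.

Lemma cofactor_neq0 j : (cofactor_poly j).[mu j] != 0.
Proof.
apply/negP => /root_prodXsubC [k kj /mu_inj E]; by rewrite E eqxx in kj.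
Qed.

Lemma prodXsubC_simple (P : pred 'I_K.+1) z :
  root (\prod_(k | P k) ('X - (mu k)%:P)) z ->
  (\prod_(k | P k) ('X - (mu k)%:P))^`().[z] != 0.
Proof.
move=> /root_prodXsubC [j Pj ->]; rewrite (bigD1 j)//= derivM derivXsubC mul1r.
rewrite hornerD hornerM hornerXsubC subrr mul0r addr0.
apply/negP => /root_prodXsubC [k /andP[_ kj] /mu_inj E].
by rewrite E eqxx in kj.
Qed.

Lemma size_full_poly : size full_poly = K.+2.
Proof. by rewrite /full_poly size_prod_XsubC /index_enum -enumT size_enum_ord. Qed.

Lemma size_cofactor_poly j : size (cofactor_poly j) = K.+1.
Proof.
have := size_full_poly; rewrite (full_polyE j) size_Mmonic ?monicXsubC//.
  by rewrite size_XsubC add2n /= => -[].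
- by rewrite polyXsubC_eq0.
- exact: monic_prod_XsubC.
Qed.

Definition pencil_mx (g : {poly C}) : 'M[C]_(K + K) :=
  invmx (disc_mx K full_poly) *m disc_mx K g.

Lemma disc_full_unit : disc_mx K full_poly \in unitmx.
Proof.
apply: disc_mx_unit; first by rewrite size_full_poly ltnS leqnSn leqnn.
by move=> z rz /eqP r'z; have := prodXsubC_simple rz; rewrite r'z eqxx.
Qed.

Lemma eigenvalue_pencil_mx g l :
  eigenvalue (pencil_mx g) l = (disc_mx K (l *: full_poly - g) \notin unitmx).
Proof.
rewrite eigenvalueNunit; congr (~~ _).
have -> : disc_mx K (l *: full_poly - g) =
    disc_mx K full_poly *m (l%:M - pencil_mx g).
  rewrite linearB /= linearZ /= mulmxBr mul_mx_scalar /pencil_mx mulmxA.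
  by rewrite mulmxV ?disc_full_unit// mul1mx.
rewrite unitmx_mul disc_full_unit /= -opprB.
by rewrite !unitmxE -scaleN1r detZ unitrM unitrX ?unitrN1.
Qed.

(** With q = [cofactor_poly j0], l w - q = (l (X - mu_j0) - 1) q. As q has simple roots, a double
    root is some mu_k at which the linear factor vanishes too: l (mu_k - mu_j0) = 1. *)
Lemma eigenvalue_pencil_cofactor j0 l : (forall j, mu j0 <= mu j) ->
  eigenvalue (pencil_mx (cofactor_poly j0)) l -> 0 < l.
Proof.
move=> j0min; rewrite eigenvalue_pencil_mx.
set q := cofactor_poly j0; set g := _ - _ => Hg.
apply/negPn/negP => l0; move/negP: Hg; apply.
(* For l = 0 the degree drops to K, a case that [disc_mx_unit] still covers. *)
have [l00|ln0] := eqVneq l 0.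
  rewrite /g l00 scale0r sub0r; apply: disc_mx_unit.
    by rewrite size_polyN size_cofactor_poly ltnSn leqnSn.
  move=> z; rewrite derivN !rootN => rz /eqP r'z.
  by have := prodXsubC_simple rz; rewrite r'z eqxx.
apply: disc_mx_unit.
  rewrite /g size_polyDl ?size_scale ?size_polyN ?size_full_poly//.
    by rewrite ltnS leqnSn leqnn.
  by rewrite size_cofactor_poly.
have gE : g = (l *: ('X - (mu j0)%:P) - 1) * q.
  by rewrite /g (full_polyE j0) scalerAl [RHS]mulrBl mul1r.
rewrite gE => z; rewrite derivM derivB derivZ derivXsubC derivC subr0 alg_polyC.
rewrite !rootE !hornerE.
set a := l * _ - 1 => /eqP aq0 /eqP aq'0.
have [qz|qz] := eqVneq q.[z] 0; last first.
  move: aq0 => /eqP; rewrite mulf_eq0 (negPf qz) orbF => /eqP a0.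
  move: aq'0; rewrite a0 mul0r addr0 => /eqP.
  by rewrite mulf_eq0 (negPf qz) (negPf ln0).
have /prodXsubC_simple q'z : root q z by rewrite rootE qz.
have [k kj0 zE] : exists2 k, k != j0 & z = mu k.
  by apply: root_prodXsubC; rewrite rootE; apply/eqP.
move: aq'0; rewrite qz mulr0 add0r => /eqP.
rewrite mulf_eq0 (negPf q'z) orbF subr_eq0 zE => /eqP E.
apply: (negP l0).
have H : 0 < mu k - mu j0.
  by rewrite subr_gt0 lt_neqAle j0min andbT (inj_eq mu_inj) eq_sym.
by rewrite -(pmulr_lgt0 _ H) E ltr01.
Qed.

(** By linearity S(w - s q) = S(w) (1 - s M), so the kernel vector given by [disc_mx_root] is an
    eigenvector of M for 1/s. *)
Lemma pencil_mx_eigvec (q : {poly C}) (s z : C) : s != 0 -> (size q <= K.+2)%N ->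
  root (full_poly - s *: q) z -> root (full_poly - s *: q)^`() z ->
  pencil_mx q *m (\col_(i < K + K) z ^+ i) = s^-1 *: \col_(i < K + K) z ^+ i.
Proof.
move=> s0 sq rz r'z; have sg : (size (full_poly - s *: q)%R <= K.+2)%N.
  rewrite (leq_trans (size_polyD _ _))// geq_max size_full_poly leqnn.
  by rewrite size_polyN (leq_trans (size_scale_leq _ _)).
have := disc_mx_root sg rz r'z; rewrite linearB /= linearZ /= mulmxBl => /eqP.
rewrite subr_eq0 -scalemxAl => /eqP /(congr1 (mulmx (invmx (disc_mx K full_poly)))).
rewrite mulKmx ?disc_full_unit// -scalemxAr mulmxA => E.
by rewrite {2}E scalerA mulVf// scale1r.
Qed.

Lemma map_conj_prodXsubC (P : pred 'I_K.+1) :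
  map_poly Num.conj (\prod_(k | P k) ('X - (mu k)%:P)) =
  \prod_(k | P k) ('X - (mu k)%:P).
Proof.
rewrite rmorph_prod; apply: eq_bigr => k _.
by rewrite rmorphB /= map_polyX map_polyC /= conj_Creal.
Qed.

(* For a real weight vector [p] and imaginary [s], complex conjugation exchanges
   the secular polynomials at [s] and [-s]; the pencil then has both [1/s] and
   [-1/s] as eigenvalues. *)
Lemma double_root_lyap p s z : (forall j, p j \is Num.real) ->
  s^* = - s -> s != 0 ->
  root (secular_poly p s) z -> root (secular_poly p s)^`() z ->
  \det (lyap_mx (pencil_mx (\sum_j p j *: cofactor_poly j))) = 0.
Proof.
move=> p_real sC s0 rz r'z; set q := \sum_j _.
have sq : (size q <= K.+2)%N.
  apply: (leq_trans (size_sum _ _ _)); apply/bigmax_leqP => j _.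
  by rewrite (leq_trans (size_scale_leq _ _))// size_cofactor_poly.
have qC : map_poly Num.conj q = q.
  rewrite rmorph_sum; apply: eq_bigr => j _.
  by rewrite /= map_polyZ /= conj_Creal// map_conj_prodXsubC.
have fC : map_poly Num.conj (secular_poly p s) = full_poly - (- s) *: q.
  by rewrite rmorphB /= map_polyZ /= qC sC map_conj_prodXsubC.
have e1 := pencil_mx_eigvec s0 sq rz r'z.
have Ns0 : - s != 0 by rewrite oppr_eq0.
have rzC : root (full_poly - (- s) *: q) z^*.
  by rewrite -fC rootE horner_map (eqP rz) rmorph0.
have r'zC : root (full_poly - (- s) *: q)^`() z^*.
  by rewrite -fC deriv_map rootE horner_map (eqP r'z) rmorph0.
have e2 := pencil_mx_eigvec Ns0 sq rzC r'zC.
(* The outer product of the eigenvectors for 1/s and -1/s is in the kernel. Its entry at (0, 0),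
   which exists as K > 0, is 1. *)
apply/eqP/det0P; exists (mxvec ((\col_(i < K + K) z ^+ i) *m
                               (\col_(i < K + K) (z^*) ^+ i)^T)).
  have i0 : (0 < K + K)%N by rewrite addn_gt0 K_gt0.
  rewrite mxvec_eq0; apply/eqP => /matrixP /(_ (Ordinal i0) (Ordinal i0)).
  by rewrite !mxE big_ord1 !mxE !expr0 mulr1 => /eqP; rewrite oner_eq0.
rewrite mul_lyap_mx mulmxA e1 -mulmxA -trmx_mul e2.
by rewrite linearZ /= -scalemxAl -scalemxAr invrN scaleNr subrr linear0.
Qed.

(** The interface to the probabilistic part: a determinant of a matrix linear in the weights,
    vanishing whenever a double root occurs, and non-zero at one vertex [j0]. *)
Lemma exists_discriminant_pencil :
  exists m (L : 'I_K.+1 -> 'M[C]_m) j0, \det (L j0) != 0 /\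
  forall p s z, (forall j, p j \is Num.real) -> s^* = - s -> s != 0 ->
    root (secular_poly p s) z -> root (secular_poly p s)^`() z ->
    \det (\sum_j p j *: L j) = 0.
Proof.
pose j0 := [arg min_(i < ord0) mu i]%O.
have j0min j : mu j0 <= mu j.
  rewrite /j0; case: real_arg_minP => // i _; exact.
exists ((K + K) * (K + K))%N, (fun j => lyap_mx (pencil_mx (cofactor_poly j))), j0.
split.
  rewrite -unitfE -unitmxE; apply: lyap_mx_unit => l el.
  apply/negP => /(eigenvalue_pencil_cofactor j0min).
  have := eigenvalue_pencil_cofactor j0min el.
  by rewrite oppr_gt0 => /lt_trans /[apply]; rewrite ltxx.
move=> p s z p_real sC s0 rz r'z.
rewrite -(double_root_lyap p_real sC s0 rz r'z); congr (\det _).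
rewrite -[LHS]/(\sum_j p j *: _) /pencil_mx linear_sum /= mulmx_sumr linear_sum /=.
by apply: eq_bigr => j _; rewrite linearZ /= -scalemxAr linearZ.
Qed.
End Pencil.

(** * The characteristic polynomial of a rank-one perturbation *)

Lemma poly_infinite_nat_roots (R : numDomainType) (p : {poly R}) :
  (forall n, exists2 k, (n <= k)%N & root p k%:R) -> p = 0.
Proof.
move=> H; apply/eqP/negPn/negP => p0.
have {}H m : exists s : seq nat, [/\ uniq s, size s = m &
    all (root p) [seq k%:R | k <- s]].
  elim: m => [|m [s [us ss rs]]]; first by exists [::].
  have [k lek rk] := H (\max_(i <- s) i).+1.
  exists (k :: s); rewrite /= us ss rk rs; split => //; rewrite andbT.
  apply/negP => ks; move: lek; rewrite ltnNge.
  by rewrite (bigD1_seq k)//= leq_maxl.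
have [s [us ss rs]] := H (size p).
have := max_poly_roots p0 rs; rewrite size_map ss ltnn.
by rewrite map_inj_uniq// => [/(_ us)//|i j /eqP]; rewrite eqr_nat => /eqP.
Qed.

(** Two triangular factorisations of one bordered matrix give the two sides. *)
Lemma det_1_sub_rank1 (F : comNzRingType) n (a : 'cV[F]_n) (b : 'rV[F]_n) :
  \det (1%:M - a *m b) = 1 - (b *m a) 0 0.
Proof.
have E1 : block_mx 1%:M a b (1%:M : 'M[F]_1) =
    block_mx 1%:M 0 b 1%:M *m block_mx 1%:M a 0 (1%:M - b *m a).
  by rewrite mulmx_block !mul1mx !mul0mx ?mulmx0 !mulmx1 !addr0 addrC subrK.
have E2 : block_mx 1%:M a b (1%:M : 'M[F]_1) =
    block_mx 1%:M a 0 1%:M *m block_mx (1%:M - a *m b) 0 b 1%:M.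
  by rewrite mulmx_block !mul1mx !mul0mx ?mulmx0 !mulmx1 ?add0r ?addr0 subrK.
have := congr1 determinant E2; rewrite E1 !det_mulmx !det_lblock !det_ublock.
by rewrite !det1 !mul1r mulr1 det_mx11 !mxE.
Qed.

Lemma horner_char_poly (F : comNzRingType) n (A : 'M[F]_n) x :
  (char_poly A).[x] = \det (x%:M - A).
Proof.
rewrite /char_poly -horner_evalE -det_map_mx; congr (\det _).
apply/matrixP => i j; rewrite !mxE rmorphB rmorphMn /= /horner_eval.
by rewrite hornerX hornerC.
Qed.

Lemma char_poly_diag_rank1 (F : numFieldType) n (d a b : 'I_n -> F) s :
  char_poly (diag_mx (\row_j d j) + s *: (\col_j a j *m \row_j b j)) =
  \prod_j ('X - (d j)%:P)
  - s *: \sum_j (a j * b j) *: \prod_(k | k != j) ('X - (d k)%:P).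
Proof.
set f := char_poly _; set w := \prod_j _; set g := w - _.
have w0 : w != 0 by rewrite -size_poly_eq0 size_prod_XsubC.
(* The factor w makes the identity trivial at the d_j; at any other x the diagonal matrix x - D is
   invertible and factors out, leaving a determinant 1 minus rank one. *)
suff : (f - g) * w = 0.
  by move/eqP; rewrite mulf_eq0 (negPf w0) orbF subr_eq0 => /eqP.
apply: poly_infinite_nat_roots => m; exists m => //.
move: (m%:R) => x; rewrite rootE hornerM hornerD hornerN mulf_eq0 subr_eq0.
have [wx0|wx] := eqVneq w.[x] 0; first by apply/orP; right; apply/eqP.
apply/orP; left.
have dx j : x - d j != 0.
  apply: contraNneq wx => dx; rewrite /w horner_prod (bigD1 j)//=.
  by rewrite hornerXsubC dx mul0r.
rewrite /f horner_char_poly.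
have -> : x%:M - (diag_mx (\row_j d j) + s *: (\col_j a j *m \row_j b j)) =
    diag_mx (\row_j (x - d j)) *m
    (1%:M - (\col_j (s * a j / (x - d j))) *m \row_j b j).
  rewrite mulmxBr mulmx1 opprD addrA; congr (_ - _).
    apply/matrixP => i j; rewrite !mxE.
    by case: eqP => [->|_]; rewrite ?mulr1n// !mulr0n subr0.
  apply/matrixP => i j; rewrite mul_diag_mx !mxE !big_ord1 !mxE.
  by field; exact: dx.
rewrite det_mulmx det_diag det_1_sub_rank1 mxE.
rewrite /g hornerD hornerN hornerZ horner_sum /w horner_prod mulrBr mulr1.
apply/eqP; congr (_ - _).
  by apply: eq_bigr => j _; rewrite mxE hornerXsubC.
rewrite !mulr_sumr; apply: eq_bigr => j _; rewrite hornerZ horner_prod !mxE.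
rewrite (bigD1 j)//= mxE.
under [X in _ = _ * (_ * X)]eq_bigr do rewrite hornerXsubC.
under eq_bigr do rewrite mxE.
by field; exact: dx.
Qed.

Lemma double_root_prodXsubC (F : fieldType) (r : seq F) : ~~ uniq r ->
  exists2 z, root (\prod_(x <- r) ('X - x%:P)) z &
             root (\prod_(x <- r) ('X - x%:P))^`() z.
Proof.
elim: r => [//|x r IH]; rewrite /= negb_and negbK big_cons => /orP[xr|/IH[z]].
  have rx : root (\prod_(y <- r) ('X - y%:P)) x by rewrite root_prod_XsubC.
  exists x; rewrite ?rootM ?root_XsubC ?eqxx// derivM derivXsubC mul1r rootE.
  by rewrite hornerD hornerM (eqP rx) hornerXsubC subrr mul0r addr0.
move=> rz r'z; exists z; first by rewrite rootM rz orbT.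
by rewrite derivM derivXsubC mul1r rootE hornerD hornerM (eqP rz) (eqP r'z) mulr0 addr0.
Qed.

Local Open Scope classical_set_scope.

(** * Classes of functions closed under ring operations and conjugation *)

Section ConjAlgebra.
Variables (R : realType) (T : Type) (S : (T -> R[i]) -> Prop).

(** This serves both for measurability in the sample point and for polynomiality in a real
    parameter. Conjugation is included because of the weights |y_j|^2. *)
Record conj_algebra : Prop := ConjAlgebra {
  alg_cst : forall c, S (fun=> c);
  alg_add : forall f g, S f -> S g -> S (fun t => f t + g t);
  alg_mul : forall f g, S f -> S g -> S (fun t => f t * g t);
  alg_conj : forall f, S f -> S (fun t => conjc (f t)) }.

Hypothesis algS : conj_algebra.

Lemma alg_sum (I : Type) (r : seq I) (F : I -> T -> R[i]) :
  (forall i, S (F i)) -> S (fun t => \sum_(i <- r) F i t).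
Proof.
move=> SF; elim: r => [|i r IH].
  by under eq_fun do rewrite big_nil; exact: alg_cst.
by under eq_fun do rewrite big_cons; exact: alg_add.
Qed.

Lemma alg_prod (I : Type) (r : seq I) (F : I -> T -> R[i]) :
  (forall i, S (F i)) -> S (fun t => \prod_(i <- r) F i t).
Proof.
move=> SF; elim: r => [|i r IH].
  by under eq_fun do rewrite big_nil; exact: alg_cst.
by under eq_fun do rewrite big_cons; exact: alg_mul.
Qed.

Lemma alg_det m (A : T -> 'M[R[i]]_m) :
  (forall i j, S (fun t => A t i j)) -> S (fun t => \det (A t)).
Proof.
move=> SA; rewrite /determinant; apply: alg_sum => s.
apply: alg_mul => //; first exact: alg_cst.
by apply: alg_prod => i; exact: SA.
Qed.
End ConjAlgebra.

Section WeightDet.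
Variables (R : realType) (m n : nat) (L : 'I_n -> 'M[R[i]]_m).
Implicit Types (w y : 'cV[R[i]]_n).

Definition weight_det y : R[i] :=
  \det (\sum_j (y j 0 * conjc (y j 0)) *: L j).

Lemma weight_detZ a y : weight_det (a *: y) = (a * conjc a) ^+ m * weight_det y.
Proof.
rewrite /weight_det -detZ scaler_sumr; congr (\det _).
apply: eq_bigr => j _; rewrite scalerA mxE rmorphM /=; congr (_ *: _).
by ring.
Qed.

Lemma weight_det_delta a j : weight_det (a *: delta_mx j 0) = (a * conjc a) ^+ m * \det (L j).
Proof.
rewrite weight_detZ; congr (_ * _); rewrite /weight_det (bigD1 j)//= big1.
  by rewrite !mxE !eqxx conjc1 mulr1 scale1r addr0.
by move=> k kj; rewrite !mxE (negPf kj) mul0r scale0r.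
Qed.

Lemma alg_weight_det T (S : (T -> R[i]) -> Prop) (y : T -> 'cV[R[i]]_n) :
  conj_algebra S -> (forall j, S (fun t => y t j 0)) ->
  S (fun t => weight_det (y t)).
Proof.
move=> algS Sy; apply: alg_det => // i j.
under eq_fun do rewrite summxE; apply: alg_sum => // k.
under eq_fun do rewrite mxE.
apply: (alg_mul algS); last exact: (alg_cst algS).
by apply: (alg_mul algS) => //; apply: (alg_conj algS).
Qed.
End WeightDet.

(** * Householder reflections *)

Section Reflection.
Variables (R : realType) (n : nat).
Implicit Types (w y : 'cV[R[i]]_n).

(* [refl w] is [adjmx w *m w] times the Householder reflection [refl_mx w];
   clearing the denominator makes it polynomial in the coordinates of [w]. *)
Definition refl w y : 'cV[R[i]]_n :=
  (adjmx w *m w) 0 0 *: y - 2%:R *: (w *m (adjmx w *m y)).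

(* At [w = 0] this is the identity, since [0^-1 = 0]. *)
Definition refl_mx w : 'M[R[i]]_n :=
  1%:M - (2%:R / (adjmx w *m w) 0 0) *: (w *m adjmx w).

Lemma adjmxM (p q r : nat) (A : 'M[R[i]]_(p, q)) (B : 'M[R[i]]_(q, r)) :
  adjmx (A *m B) = adjmx B *m adjmx A.
Proof. by rewrite /adjmx map_mxM trmx_mul. Qed.

Lemma adjmxK (p q : nat) (A : 'M[R[i]]_(p, q)) : adjmx (adjmx A) = A.
Proof. by apply/matrixP => i j; rewrite !mxE conjcK. Qed.

Lemma dot_adj w y : (adjmx w *m y) 0 0 = \sum_j conjc (w j 0) * y j 0.
Proof. by rewrite mxE; apply: eq_bigr => j _; rewrite !mxE. Qed.

Lemma dot_adj_conj w : conjc ((adjmx w *m w) 0 0) = (adjmx w *m w) 0 0.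
Proof.
rewrite dot_adj rmorph_sum; apply: eq_bigr => j _.
by rewrite rmorphM /= conjcK mulrC.
Qed.

Lemma dot_adj_eq0 w : (adjmx w *m w) 0 0 = 0 -> w = 0.
Proof.
rewrite dot_adj => /eqP; rewrite psumr_eq0; last first.
  by move=> j _; rewrite mulrC mulcJ_ge0.
move=> /allP w0; apply/colP => j; rewrite mxE.
have := w0 j (mem_index_enum j).
by rewrite mulf_eq0 conjc_eq0 orbb => /eqP.
Qed.

Lemma refl_mx_unitary w : unitary_mx (refl_mx w).
Proof.
rewrite /unitary_mx; set c := (adjmx w *m w) 0 0.
have cC : conjc (2%:R / c) = 2%:R / c by rewrite rmorphM fmorphV rmorph_nat /= dot_adj_conj.
have -> : adjmx (refl_mx w) = refl_mx w.
  rewrite {1}/refl_mx /adjmx map_mxB linearB /= map_mxZ linearZ /= cC.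
  rewrite -/(adjmx (w *m adjmx w)) adjmxM adjmxK.
  by rewrite map_mx1 trmx1.
rewrite /refl_mx -/c mulmxBl mul1mx mulmxBr mulmx1 -scalemxAl -scalemxAr scalerA.
have -> : w *m adjmx w *m (w *m adjmx w) = c *: (w *m adjmx w).
  rewrite mulmxA -[w *m _ *m w]mulmxA [adjmx w *m w]mx11_scalar -/c.
  by rewrite mul_mx_scalar scalemxAl.
rewrite scalerA (_ : _ * c = 2%:R / c + 2%:R / c).
  by rewrite scalerDl opprB addrK subrK.
have [->|c0] := eqVneq c 0; first by rewrite invr0 !mulr0 addr0.
by field.
Qed.

Lemma reflE w y : refl w y = (adjmx w *m w) 0 0 *: (refl_mx w *m y).
Proof.
have [/dot_adj_eq0 ->|c0] := eqVneq ((adjmx w *m w) 0 0) 0.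
  by rewrite /refl mul0mx scaler0 subr0 mulmx0 mxE !scale0r.
rewrite /refl /refl_mx; move: ((adjmx w *m w) 0 0) c0 => c c0.
rewrite mulmxBl mul1mx scalerBr -scalemxAl scalerA -mulmxA.
have -> : c * (2%:R / c) = 2%:R by rewrite mulrCA mulfV ?mulr1.
by [].
Qed.

Lemma alg_refl T (S : (T -> R[i]) -> Prop) (w y : T -> 'cV[R[i]]_n) :
  conj_algebra S -> (forall j, S (fun t => w t j 0)) ->
  (forall j, S (fun t => y t j 0)) -> forall j, S (fun t => refl (w t) (y t) j 0).
Proof.
move=> algS Sw Sy j.
have Sdot (z : T -> 'cV_n) : (forall j, S (fun t => z t j 0)) ->
    S (fun t => (adjmx (w t) *m z t) 0 0).
  move=> Sz; under eq_fun do rewrite dot_adj; apply: alg_sum => // k.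
  by apply: (alg_mul algS) => //; apply: (alg_conj algS).
have rE t : refl (w t) (y t) j 0 =
    (adjmx (w t) *m w t) 0 0 * y t j 0
    + - 2%:R * (w t j 0 * (adjmx (w t) *m y t) 0 0).
  rewrite /refl; move: (adjmx _ *m w t) (adjmx _ *m y t) => b c.
  by rewrite !mxE big_ord1 mulNr.
under eq_fun do rewrite rE.
apply: (alg_add algS); apply: (alg_mul algS) => //.
- exact: Sdot.
- exact: (alg_cst algS).
- by apply: (alg_mul algS) => //; exact: Sdot.
Qed.

(* The phase of [a] is chosen so that [v] and [a *: delta_mx j 0] make an obtuse
   angle; this rules out [w = 0]. *)
Lemma exists_reflection v j : unit_vector v ->
  exists w a, a != 0 /\ refl w v = a *: delta_mx j 0.
Proof.
move=> v1; set z : R[i] := v j 0.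
have [ph phph phzle] : exists2 ph : R[i], ph * conjc ph = 1 &
    exists2 r, 0 <= r & conjc ph * z = - r.
  have [z0|z0] := eqVneq z 0.
    by exists 1; rewrite ?rmorph1 ?mulr1//; exists 0; rewrite ?z0 ?mulr0 ?oppr0.
  have n0 : `|z| != 0 by rewrite normr_eq0.
  have nC : conjc `|z| = `|z| by exact: (conj_Creal (normr_real z)).
  have zz : z * conjc z = `|z| ^+ 2 by rewrite normCK.
  have cE : conjc (- z / `|z|) = - conjc z / `|z|.
    rewrite rmorphM fmorphV rmorphN /=; congr (_ / _); exact: nC.
  exists (- z / `|z|); rewrite cE; last exists `|z| => //.
    move: (conjc z) (`|z|) n0 zz => zb nz n0 zz.
    by transitivity (z * zb / nz ^+ 2); [field|rewrite zz divff ?expf_neq0].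
  move: (conjc z) (`|z|) n0 zz => zb nz n0 zz.
  by transitivity (- (z * zb) / nz); [field|rewrite zz; field].
have [r r0 phzr] := phzle.
set e : 'cV[R[i]]_n := delta_mx j 0.
have ev (y : 'cV_n) : adjmx e *m y = (y j 0)%:M.
  apply/matrixP => a b; rewrite !ord1 dot_adj mxE eqxx mulr1n (bigD1 j)//= big1.
    by rewrite !mxE !eqxx rmorph1 mul1r addr0.
  by move=> k kj; rewrite !mxE (negPf kj) rmorph0 mul0r.
have vv : adjmx v *m v = 1%:M.
  by apply/matrixP => a b; rewrite !ord1 dot_adj mxE eqxx -[RHS]v1.
have ee : adjmx e *m e = 1%:M by rewrite ev mxE !eqxx.
have ve : adjmx v *m e = (conjc z)%:M.
  rewrite -[adjmx v *m e]adjmxK adjmxM adjmxK ev.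
  by apply/matrixP => a b; rewrite !ord1 !mxE eqxx !mulr1n.
have rC : conjc r = r by exact: (conj_Creal (ger0_real r0)).
have phzrC : ph * conjc z = - r by rewrite -rC -rmorphN /= -phzr rmorphM /= conjcK.
(* Reflecting along the difference of the unit vectors v and ph e_j exchanges them; 2 + 2r is the
   squared norm of that difference, the factor carried by [refl]. *)
exists (v - ph *: e), ((2%:R + 2%:R * r) * ph); split.
  rewrite mulf_neq0//; last by apply: contra_eq_neq phph => ->; rewrite mul0r eq_sym oner_eq0.
  by rewrite gt_eqF// -[ltLHS]addr0 ltr_leD ?mulr_ge0 ?ler0n ?ltr0n.
have adjw : adjmx (v - ph *: e) = adjmx v - conjc ph *: adjmx e.
  by rewrite /adjmx map_mxB linearB /= map_mxZ linearZ.
have wv : adjmx (v - ph *: e) *m v = (1 + r)%:M.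
  rewrite adjw mulmxBl -scalemxAl vv ev -/z scale_scalar_mx phzr -raddfB /=.
  by rewrite opprK.
have wo : adjmx (v - ph *: e) *m (ph *: e) = (- r - 1)%:M.
  rewrite adjw mulmxBl -scalemxAl -!scalemxAr ve ee !scale_scalar_mx -raddfB /=.
  by rewrite phzrC mulr1 [conjc ph * ph]mulrC phph.
have ww : adjmx (v - ph *: e) *m (v - ph *: e) = (2%:R + 2%:R * r)%:M.
  rewrite mulmxBr wv wo -raddfB /=; congr (_%:M); ring.
rewrite /refl ww wv mxE eqxx mulr1n mul_mx_scalar scalerA.
have -> : 2%:R * (1 + r) = 2%:R + 2%:R * r by rewrite mulrDr mulr1.
by rewrite scalerBr opprB addrC subrK scalerA.
Qed.
End Reflection.

(** * Polynomial functions of a real parameter *)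

Section PolynomialFunctions.
Variable R : realType.

(** The argument is real so that conjugating the coefficients conjugates the value. *)
Definition polyfun (f : R -> R[i]) : Prop :=
  exists p : {poly R[i]}, forall x, f x = p.[x%:C%C].

Lemma polyfun_algebra : conj_algebra polyfun.
Proof.
split=> [c|f g [p fE] [q gE]|f g [p fE] [q gE]|f [p fE]].
- by exists c%:P => x; rewrite hornerC.
- by exists (p + q) => x; rewrite hornerD fE gE.
- by exists (p * q) => x; rewrite hornerM fE gE.
- exists (map_poly Num.conj p) => x.
  have xC : Num.conj (x%:C%C : R[i]) = x%:C%C by exact: (conjc_real x).
  by rewrite fE -[in RHS]xC horner_map.
Qed.

Lemma polyfun_id : polyfun (fun x => x%:C%C).
Proof. by exists 'X => x; rewrite hornerX. Qed.

Lemma polyfun_infinite_zeros f : polyfun f ->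
  (forall n, exists2 k, (n <= k)%N & f k%:R = 0) -> forall x, f x = 0.
Proof.
move=> [p fE] zeros x; rewrite fE (@poly_infinite_nat_roots _ p) ?horner0// => n.
have [k nk fk] := zeros n; exists k => //.
by rewrite rootE -fk fE rmorph_nat.
Qed.
End PolynomialFunctions.

(** * Measurable complex functions *)

Section MeasurableComplex.
Variables (R : realType) (d : measure_display) (T : measurableType d).

Definition cmeasurable (f : T -> R[i]) : Prop :=
  measurable_fun setT (fun t => complex.Re (f t)) /\
  measurable_fun setT (fun t => complex.Im (f t)).

Lemma cmeasurable_algebra : conj_algebra cmeasurable.
Proof.
split=> [c|f g [f1 f2] [g1 g2]|f g [f1 f2] [g1 g2]|f [f1 f2]].
- by split; exact: measurable_cst.
- split; [under eq_fun do rewrite raddfD/=|under eq_fun do rewrite raddfD/=];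
    exact: measurable_realfun.measurable_funD.
- split.
    rewrite [X in measurable_fun _ X](_ : _ = fun t =>
      complex.Re (f t) * complex.Re (g t) - complex.Im (f t) * complex.Im (g t)).
      by apply: measurable_realfun.measurable_funB; exact: measurable_realfun.measurable_funM.
    by apply/funext => t; case: (f t) (g t) => [a b] [a' b'].
  rewrite [X in measurable_fun _ X](_ : _ = fun t =>
      complex.Re (f t) * complex.Im (g t) + complex.Im (f t) * complex.Re (g t)).
    by apply: measurable_realfun.measurable_funD; exact: measurable_realfun.measurable_funM.
  by apply/funext => t; case: (f t) (g t) => [a b] [a' b'].
- split.
    rewrite [X in measurable_fun _ X](_ : _ = fun t => complex.Re (f t))//.
    by apply/funext => t; case: (f t).
  rewrite [X in measurable_fun _ X](_ : _ = fun t => - complex.Im (f t)).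
    exact: measurableT_comp.
  by apply/funext => t; case: (f t).
Qed.

Lemma measurable_zeros f : cmeasurable f -> measurable [set t | f t = 0].
Proof.
move=> [f1 f2].
rewrite (_ : [set t | _] = (setT `&` (fun t => complex.Re (f t)) @^-1` [set 0]) `&`
                           (setT `&` (fun t => complex.Im (f t)) @^-1` [set 0])).
  by apply: measurableI; [apply: f1|apply: f2].
apply/seteqP; split => t /=; first by move=> ->; split; split.
by case: (f t) => a b /= [[_ ->] [_ ->]].
Qed.
End MeasurableComplex.

(** * Iterated limits superior of events *)

Section IteratedLimSup.
Variables (R : realType) (d : measure_display) (Omega : measurableType d).
Variables (P : probability Omega R) (I : eqType).
Implicit Types (x y : I -> R) (E : (I -> R) -> set Omega).

(** The tail unions decrease to the limsup and each has probability at least c; continuity from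
    above concludes. *)
Lemma probability_lim_sup_ge (F : (set Omega)^nat) (c : \bar R) :
  (forall n, measurable (F n)) -> (forall n, (c <= P (F n))%E) ->
  (c <= P (lim_sup_set F))%E.
Proof.
move=> mF cF; have mU n : measurable (\bigcup_(k in [set k | (n <= k)%N]) F k).
  exact: bigcup_measurable.
have H := lim_sup_set_cvg P F mF.
have fin : (P (\bigcup_(k in [set k | (0 <= k)%N]) F k) < +oo)%E.
  by rewrite (le_lt_trans (probability_le1 P (mU 0%N)))// ltry.
rewrite -(cvg_lim _ (H fin))//; apply: lime_ge; first by apply: cvgP (H fin).
apply: nearW => n; apply: (le_trans (cF n)); apply: le_measure; rewrite ?inE//.
by apply: bigcup_sup; rewrite /=.
Qed.

Definition upd x i a : I -> R := fun k => if k == i then a else x k.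

Definition iter_lim_sup E (s : seq I) : (I -> R) -> set Omega :=
  foldr (fun i F x => lim_sup_set (fun n => F (upd x i n%:R))) E s.

Lemma iter_lim_sup_ge E s (c : \bar R) :
  (forall x, measurable (E x)) -> (forall x, (c <= P (E x))%E) ->
  forall x, measurable (iter_lim_sup E s x) /\ (c <= P (iter_lim_sup E s x))%E.
Proof.
move=> mE cE; elim: s => [|i s IH] x /=; first by split.
split; last by apply: probability_lim_sup_ge => n; have [] := IH (upd x i n%:R).
apply: bigcap_measurable => // n _; apply: bigcup_measurable => k _.
by have [] := IH (upd x i k%:R).
Qed.

(** Each limsup provides infinitely many natural values of one parameter, and the closure hypothesis
    extends them to all real values. After all levels, every parameter in [s] is free. *)
Lemma iter_lim_sup_sub E s x y t :
  (forall z i, (forall n, exists2 k, (n <= k)%N & E (upd z i k%:R) t) ->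
     forall a, E (upd z i a) t) ->
  iter_lim_sup E s x t -> (forall i, i \notin s -> y i = x i) -> E y t.
Proof.
move=> closed; elim: s x y => [|i s IH] x y /=.
  by move=> Ex yx; rewrite (_ : y = x)//; apply/funext => i; exact: yx.
move=> lim yx.
have -> : y = upd y i (y i) by apply/funext => k; rewrite /upd; case: eqP => [->|].
apply: closed => n; have [k nk Ek] := lim n Logic.I.
exists k => //; apply: (IH (upd x i k%:R)) => // j js.
by rewrite /upd; case: eqP => // /eqP ji; rewrite yx// inE negb_or ji.
Qed.
End IteratedLimSup.

(** * Almost sure non-vanishing of the weighted determinant *)

Section NullSet.
Variables (R : realType) (d : measure_display) (Omega : measurableType d).
Variables (P : probability Omega R) (n : nat) (v : Omega -> 'cV[R[i]]_n).
Hypothesis v_unif : uniform_on_sphere P v.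

Definition decode (y : n.-tuple (R * R)%type) : 'cV[R[i]]_n :=
  \col_j Complex (tnth y j).1 (tnth y j).2.

Lemma encodeK : cancel (@encode R n) decode.
Proof.
move=> x; apply/colP => j; rewrite !mxE tnth_mktuple /=.
by case: (x j 0).
Qed.

Lemma cmeasurable_decode j : cmeasurable (fun y => decode y j 0).
Proof.
split.
  under eq_fun do rewrite mxE /=.
  exact: (measurableT_comp measurable_fst (measurable_tnth j)).
under eq_fun do rewrite mxE /=.
exact: (measurableT_comp measurable_snd (measurable_tnth j)).
Qed.

Lemma cmeasurable_coord j : cmeasurable (fun t => v t j 0).
Proof.
have [mv _ _] := v_unif.
have [m1 m2] := cmeasurable_decode j.
have vE t : v t = decode ((@encode R n \o v) t) by rewrite /= encodeK.
split; under eq_fun do rewrite vE.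
  exact: (measurableT_comp m1 mv).
exact: (measurableT_comp m2 mv).
Qed.

Lemma ae_weight_det_neq0 m (L : 'I_n -> 'M[R[i]]_m) j0 : \det (L j0) != 0 ->
  {ae P, forall t, weight_det L (v t) != 0}.
Proof.
move=> detL; have [_ v1 vU] := v_unif.
pose A := [set y | weight_det L (decode y) = 0].
have mA : measurable A.
  apply: measurable_zeros; apply: alg_weight_det; first exact: cmeasurable_algebra.
  exact: cmeasurable_decode.
(* The boolean selects the real ([false]) or the imaginary ([true]) part of a coordinate. *)
pose wv (x : 'I_n * bool -> R) : 'cV[R[i]]_n := \col_j Complex (x (j, false)) (x (j, true)).
pose E x := [set t | weight_det L (refl (wv x) (v t)) = 0].
have mE x : measurable (E x).
  apply: measurable_zeros; apply: alg_weight_det; first exact: cmeasurable_algebra.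
  apply: alg_refl; first exact: cmeasurable_algebra.
    by move=> j; apply: (alg_cst (cmeasurable_algebra _ _)).
  exact: cmeasurable_coord.
pose c := P ((@encode R n \o v) @^-1` A).
have m0 : measurable ((@encode R n \o v) @^-1` A).
  by have [mv _ _] := v_unif; rewrite -[X in measurable X]setTI; exact: mv.
(* Only an inequality: [refl] is a multiple of the unitary reflection, and that multiple is 0 when
   [wv x] = 0. *)
have cE x : (c <= P (E x))%E.
  rewrite /c (vU _ (refl_mx_unitary (wv x)))//; apply: le_measure; rewrite ?inE//.
    rewrite (_ : _ @^-1` A = [set t | weight_det L (refl_mx (wv x) *m v t) = 0]).
      apply: measurable_zeros; apply: alg_weight_det; first exact: cmeasurable_algebra.
      move=> j; under eq_fun do rewrite mxE.
      apply: alg_sum => [|k]; first exact: cmeasurable_algebra.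
      apply: (alg_mul (cmeasurable_algebra _ _)); last exact: cmeasurable_coord.
      exact: (alg_cst (cmeasurable_algebra _ _)).
    by apply/seteqP; split => t; rewrite /A /= encodeK.
  by move=> t; rewrite /A /E /= encodeK reflE weight_detZ => ->; rewrite mulr0.
have closed t z i : (forall n, exists2 k, (n <= k)%N & E (upd z i k%:R) t) ->
    forall a, E (upd z i a) t.
  apply: polyfun_infinite_zeros.
  apply: alg_weight_det; first exact: polyfun_algebra.
  apply: alg_refl; first exact: polyfun_algebra.
    move=> j; rewrite (_ : (fun _ => _) = fun a =>
        (upd z i a (j, false))%:C%C + 'i%C * (upd z i a (j, true))%:C%C).
      have pu k : polyfun (fun a => (upd z i a k)%:C%C).
        rewrite /upd; case: eqP => _; first exact: polyfun_id.
        exact: (alg_cst (polyfun_algebra _)).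
      apply: (alg_add (polyfun_algebra _)) => //.
      apply: (alg_mul (polyfun_algebra _)) => //.
      exact: (alg_cst (polyfun_algebra _)).
    by apply/funext => a; rewrite mxE [LHS]complexE.
  by move=> j; exact: (alg_cst (polyfun_algebra _)).
have [mlim clim] := iter_lim_sup_ge (enum {: 'I_n * bool}) mE cE (fun=> 0).
(* All parameters are enumerated, so a point of this limsup lies in every [E x], in particular for
   the reflection sending v to a multiple of e_j0, where the determinant is non-zero. *)
have c0 : P (iter_lim_sup E (enum {: 'I_n * bool}) (fun=> 0)) = 0%E.
  apply/negligibleP => //; apply: negligibleS v1 => t /= lim v1.
  have [w [a [a0 wE]]] := exists_reflection j0 v1.
  pose x (k : 'I_n * bool) :=
    if k.2 then complex.Im (w k.1 0) else complex.Re (w k.1 0).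
  have : weight_det L (refl (wv x) (v t)) = 0.
    by apply: (iter_lim_sup_sub (closed t) lim) => k; rewrite mem_enum.
  have -> : wv x = w by apply/colP => j; rewrite mxE /x /=; case: (w j 0).
  rewrite wE weight_det_delta => /eqP.
  by rewrite mulf_eq0 (negPf detL) orbF expf_eq0 mulf_eq0 conjc_eq0 orbb (negPf a0) andbF.
have Pc : c = 0%E.
  by apply/eqP; rewrite eq_le measure_ge0 andbT -[leRHS]c0.
have : P.-negligible ((@encode R n \o v) @^-1` A) by apply/negligibleP.
apply: negligibleS => t /=; rewrite /A /= encodeK.
by move=> /negP/negPn/eqP.
Qed.
End NullSet.

(** * Reduction to a diagonal matrix *)

Lemma simple_roots_n_distinct (R : rcfType) n (A : 'M[R[i]]_n) :
  (forall z, root (char_poly A) z -> root (char_poly A)^`() z -> False) ->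
  n_distinct_eigenvalues A n.
Proof.
move=> simple; have [r rE] := closed_field_poly_normal (char_poly A).
rewrite (monicP (char_poly_monic A)) scale1r in rE.
exists r; split.
- apply/negPn/negP => /double_root_prodXsubC [z]; rewrite -rE; exact: simple.
- by have := size_char_poly A; rewrite rE size_prod_XsubC => -[].
- by move=> z; rewrite eigenvalue_root_char rE root_prod_XsubC.
Qed.

Lemma eigenvalue_conj (F : fieldType) n (P B : 'M[F]_n) z : P \in unitmx ->
  eigenvalue (invmx P *m B *m P) z = eigenvalue B z.
Proof.
move=> Pu; rewrite !eigenvalueNunit; congr (~~ _).
rewrite (_ : _ - _ = invmx P *m (B - z%:M) *m P).
  by rewrite !unitmx_mul unitmx_inv Pu andbT.
by rewrite mulmxBr mulmxBl mul_mx_scalar -scalemxAl mulVmx// scalemx1.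
Qed.

Lemma eq_n_distinct_eigenvalues (R : rcfType) n (A B : 'M[R[i]]_n) k :
  eigenvalue A =1 eigenvalue B ->
  n_distinct_eigenvalues A k -> n_distinct_eigenvalues B k.
Proof.
move=> AB [s [us ss sE]]; exists s; split=> [||z]; [exact: us|exact: ss|].
by rewrite -AB; exact: sE.
Qed.

Lemma hermitian_diagonalization (R : rcfType) n (H : 'M[R[i]]_n) :
  hermitian_mx H -> exists U (mu : 'I_n -> R[i]),
  [/\ unitary_mx U, H = invmx U *m diag_mx (\row_j mu j) *m U &
      forall j, mu j \is Num.real].
Proof.
move=> hermH; have Hherm : H \is hermitianmx _ false Num.conj.
  by apply/is_hermitianmxP; rewrite expr0 scale1r -map_trmx -[LHS]hermH.
exists (spectralmx H), (spectral_diag H 0); split.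
- by rewrite /unitary_mx /adjmx map_trmx; apply/unitarymxP/spectral_unitarymx.
- have DE : \row_j spectral_diag H 0 j = spectral_diag H.
    by apply/rowP => j; rewrite mxE.
  by rewrite DE; exact: orthomx_spectralP (hermitian_normalmx Hherm).
- by move=> j; exact: (mxOverP (hermitian_spectral_diag_real Hherm)).
Qed.

(** Pigeonhole: n distinct eigenvalues all occur in the list of the n values of [mu]. *)
Lemma n_distinct_diag_inj (R : rcfType) n (mu : 'I_n -> R[i]) :
  n_distinct_eigenvalues (diag_mx (\row_j mu j)) n -> injective mu.
Proof.
move=> [s [us ss sE]]; apply/injectiveP; rewrite /injectiveb /dinjectiveb.
apply: (leq_size_uniq us); last by rewrite size_map -cardE card_ord ss.
move=> z /sE; rewrite eigenvalue_root_char char_poly_trig; last first.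
  exact/is_diag_mx_is_trig/diag_mx_is_diag.
rewrite rootE horner_prod => /prodf_eq0 [j _].
rewrite hornerXsubC !mxE eqxx mulr1n subr_eq0 => /eqP ->.
exact: map_f (mem_enum _ _).
Qed.

(** This allows passing to an eigenbasis of H. For invariance, the laws of U v and of V U v are both
    compared with that of v. *)
Lemma uniform_on_sphere_unitary (R : realType) (d : measure_display)
    (Omega : measurableType d) (P : probability Omega R) n
    (v : Omega -> 'cV[R[i]]_n) (U : 'M[R[i]]_n) :
  unitary_mx U -> uniform_on_sphere P v ->
  uniform_on_sphere P (fun t => U *m v t).
Proof.
move=> unitU v_unif; have [_ v1 vU] := v_unif; split.
- have cm j : cmeasurable (fun t => (U *m v t) j 0).
    under eq_fun do rewrite mxE.
    apply: alg_sum => [|k]; first exact: cmeasurable_algebra.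
    apply: (alg_mul (cmeasurable_algebra _ _)); last exact: cmeasurable_coord v_unif k.
    exact: (alg_cst (cmeasurable_algebra _ _)).
  apply/measurable_fun_tnthP => j.
  rewrite (_ : _ \o _ = fun t => (complex.Re ((U *m v t) j 0), complex.Im ((U *m v t) j 0))).
    by apply: measurable_fun_pair; have [] := cm j.
  by apply/funext => t; rewrite /= /encode tnth_mktuple.
- apply: filterS v1 => t; rewrite /unit_vector -!dot_adj => v1.
  rewrite adjmxM -mulmxA [adjmx U *m _]mulmxA.
  by rewrite (mulmx1C unitU) mul1mx.
- move=> V unitV A mA; rewrite -[LHS](vU U unitU A mA).
  have unitVU : unitary_mx (V *m U).
    by rewrite /unitary_mx adjmxM mulmxA -[V *m U *m _]mulmxA unitU mulmx1.
  rewrite (vU _ unitVU A mA); congr (P (_ @^-1` A)).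
  by apply/funext => t; rewrite mulmxA.
Qed.

(** The 1 x 1 matrices L_k, equal to 1 for k = j and 0 otherwise, make the determinant |v_j|^2. *)
Lemma ae_coord_neq0 (R : realType) (d : measure_display)
    (Omega : measurableType d) (P : probability Omega R) n
    (v : Omega -> 'cV[R[i]]_n) :
  uniform_on_sphere P v -> {ae P, forall t, forall j, v t j 0 != 0}.
Proof.
move=> v_unif; apply: filter_forall => j.
pose L (k : 'I_n) : 'M[R[i]]_1 := (k == j)%:R%:M.
have Lj : \det (L j) != 0 by rewrite /L eqxx det1 oner_neq0.
apply: filterS (ae_weight_det_neq0 v_unif Lj) => t; apply: contra_neq => vj.
rewrite /weight_det big1 ?det0// => k _; rewrite /L.
by case: eqP => [->|_]; rewrite ?vj ?mul0r ?scale0r// raddf0 scaler0.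
Qed.

(** * Spectra along the perturbation, and the theorem *)

Section RankOnePerturbation.
Variables (R : realType) (K : nat) (mu : 'I_K.+1 -> R[i]) (u : 'cV[R[i]]_K.+1).
Hypothesis mu_inj : injective mu.

Let p j := u j 0 * conjc (u j 0).
Let G s := diag_mx (\row_j mu j) + s *: (u *m adjmx u).

Lemma char_poly_rank1 s : char_poly (G s) = secular_poly mu p s.
Proof.
have uE : u = \col_j u j 0 by apply/colP => j; rewrite mxE.
have uE' : adjmx u = \row_j conjc (u j 0) by apply/rowP => j; rewrite !mxE.
by rewrite /G uE' {1}uE char_poly_diag_rank1.
Qed.

Lemma eigenvalue_rank1_inj s s' z : (forall j, u j 0 != 0) ->
  eigenvalue (G s) z -> eigenvalue (G s') z -> s = s'.
Proof.
move=> u0; rewrite !eigenvalue_root_char !char_poly_rank1 /secular_poly !rootE.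
rewrite !hornerD !hornerN !hornerZ !subr_eq0 => /eqP e1 /eqP e2.
apply/eqP; rewrite -subr_eq0; apply/negPn/negP => ss'.
have /eqP : (s - s') * (\sum_j p j *: cofactor_poly mu j).[z] = 0.
  by rewrite mulrBl -e1 -e2 subrr.
rewrite mulf_eq0 (negPf ss') /= => /eqP q0.
have /root_prodXsubC [j _ zE] : root (full_poly mu) z by rewrite rootE e1 q0 mulr0.
(* At mu_j every cofactor but the j-th vanishes, so q(mu_j) is p_j times a non-zero number. *)
move: q0; rewrite zE horner_sum (bigD1 j)//= big1 ?addr0.
  apply/eqP; rewrite hornerZ mulf_neq0 ?cofactor_neq0//.
  by rewrite mulf_neq0 ?conjc_eq0.
move=> k kj; rewrite hornerZ /cofactor_poly (bigD1 j) ?(eq_sym j)//=.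
by rewrite hornerM hornerXsubC subrr mul0r mulr0.
Qed.
End RankOnePerturbation.

Theorem theorem1p3 (R : realType) (N : nat) (H : 'M[R[i]]_N)
  (d : measure_display) (Omega : measurableType d) (P : probability Omega R)
  (v : Omega -> 'cV[R[i]]_N) :
  (5 <= N)%N ->
  hermitian_mx H ->
  n_distinct_eigenvalues H N ->
  uniform_on_sphere P v ->
  {ae P, forall w,
     (forall t : R, 0 <= t -> n_distinct_eigenvalues (Gt H (v w) t) N) /\
     (forall t s : R, 0 <= t -> 0 <= s -> t <> s ->
        forall z : R[i], ~ (eigenvalue (Gt H (v w) t) z /\
                            eigenvalue (Gt H (v w) s) z))}.
Proof.
case: N H v => [//|K] H v leK hermH distH v_unif.
have [U [mu [unitU HE mu_real]]] := hermitian_diagonalization hermH.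
have Uu : U \in unitmx by have [] := mulmx1_unit unitU.
have mu_inj : injective mu.
  apply/n_distinct_diag_inj/(eq_n_distinct_eigenvalues _ distH) => z.
  by rewrite -[RHS](eigenvalue_conj _ z Uu) -HE.
have K0 : (0 < K)%N by rewrite -ltnS (leq_trans _ leK).
have [m [L [j0 [detL Lzero]]]] := exists_discriminant_pencil K0 mu_inj mu_real.
have u_unif := uniform_on_sphere_unitary unitU v_unif.
apply: filterS2 (ae_coord_neq0 u_unif) (ae_weight_det_neq0 u_unif detL) => w.
move: (v w) => x x0 disc.
have GE t : Gt H x t = invmx U *m
    (diag_mx (\row_j mu j) + Complex 0 t *: ((U *m x) *m adjmx (U *m x))) *m U.
  rewrite /Gt {1}HE mulmxDr mulmxDl; congr (_ + _).
  rewrite -scalemxAr -scalemxAl; congr (_ *: _).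
  by rewrite adjmxM -!mulmxA (mulmx1C unitU) mulmx1 mulKmx.
have eqG t : eigenvalue (diag_mx (\row_j mu j) +
    Complex 0 t *: ((U *m x) *m adjmx (U *m x))) =1 eigenvalue (Gt H x t).
  by move=> z; rewrite GE; exact/esym/eigenvalue_conj.
split=> [t t0|t s t0 s0 ts z []]; last first.
  rewrite -(eqG t) => e1; rewrite -(eqG s) => e2.
  by have [] := eigenvalue_rank1_inj mu_inj x0 e1 e2.
apply: (eq_n_distinct_eigenvalues (eqG t)); apply: simple_roots_n_distinct => z; rewrite char_poly_rank1.
(* The pencil needs 1/s, so t = 0 is separate: there the secular polynomial is w, whose roots are
   simple. *)
have [->|tn0] := eqVneq t 0.
  rewrite /secular_poly scale0r subr0 => rz.
  by have := prodXsubC_simple mu_inj rz; rewrite -rootE => /negP.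
move=> rz r'z; move/eqP: disc; apply; apply: (Lzero _ (Complex 0 t) z) => //.
- by move=> j; apply: ger0_real; exact: mulcJ_ge0.
- by rewrite -[LHS]/(conjc _) /= -[RHS]/(Complex (- 0) (- t)) oppr0.
- by apply: contra_neq tn0 => -[].
Qed.
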